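(* There is an absolute constant $c>0$ such that if $n$ is sufficiently large and $q$ is an integer with $1 \le q < cn$, then every $n$-vertex graph with $\lfloor n^2/4\rfloor+q$ edges contains at least $$q\left\lfloor \frac{n}{2}\right\rfloor\left(\left\lfloor \frac{n}{2}\right\rfloor-1\right)\left(\left\lceil \frac{n}{2}\right\rceil-2\right)$$ copies of a five cycle $C_5$.
   Context: Graphs are finite and simple. A copy of $C_5$ in a graph $H$ is a set of $5$ vertices and $5$ edges of $H$ forming a (not necessarily induced) subgraph isomorphic to the cycle $C_5$; equivalently, the number of copies of $C_5$ in $H$ is the number of edge-preserving injections $V(C_5)\to V(H)$ divided by the number of automorphisms of $C_5$ (which is $10$). *)

(* Defs.v *)
From mathcomp Require Import all_boot all_order all_algebra.
From mathcomp Require Import reals.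

Set Implicit Arguments.
Unset Strict Implicit.
Unset Printing Implicit Defensive.

(* A finite simple graph is a symmetric irreflexive adjacency relation on a
   finite type; its edges are unordered pairs, encoded as vertex sets. *)
Definition edges (T : finType) (e : rel T) : {set {set T}} :=
  [set [set u.1; u.2] | u : T * T & e u.1 u.2].

(* [ordS] is the successor modulo 5. *)
Definition C5 : rel 'I_5 := fun i j => (j == ordS i) || (i == ordS j).

(* Copies are counted as subgraphs (V, E), not as labelled embeddings: the ten
   embeddings [f] that differ by an automorphism of C5 yield the same pair. *)
Definition C5_copies (T : finType) (e : rel T) : {set {set T} * {set {set T}}} :=
  [set H : {set T} * {set {set T}} |
    (H.2 \subset edges e) &&
    [exists f : {ffun 'I_5 -> T},
      [&& injectiveb f,
          H.1 == f @: [set: 'I_5] &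
          H.2 == [set f @: A | A : {set 'I_5} in edges C5]]]].

(* Main.v *)
From Stdlib Require Import ZArith Lia.
Require Import Defs.
From mathcomp Require Import all_boot all_order all_algebra.
From mathcomp Require Import reals.
From mathcomp Require Import zify.

(* Suppose there are fewer copies than claimed, hence only O(n^4).  Two uses of
   Cauchy-Schwarz give many copies of the wheel K_{1,2,2}, which contains C5, as
   soon as there are many triangles; so there are o(n^3) triangles.  Averaging
   over the vertices x, the cut (N(x), complement) has on average at most
   2 #(triangle homomorphisms) / n ordered inside edges, so in a maximum cut there
   are at most n^2 / 4000 inside edges; the numbers M of missing cross pairs and
   D = floor(n^2/4) - p r (p, r the part sizes) then satisfy I = q + M + D for the
   number I of inside edges.  An inside edge xy with both cross degrees >= n / 20
   closes at least n^3 / 3000 cross paths x u a v y into five-cycles.  A vertex of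
   smaller cross degree has few inside edges, by maximality of the cut, but many
   missing pairs, which force more good inside edges than the number of copies
   allows; so there is no such vertex and I <= 3 n / 1000.  Now every inside edge
   lies in at least r (r - 1) (p - 2) - O(M n^2) copies, and the M + D extra inside
   edges outweigh all the losses. *)

Set Implicit Arguments.
Unset Strict Implicit.
Unset Printing Implicit Defensive.

(** * Arithmetic *)

Section Arith.
Local Open Scope Z_scope.

(** Serves to pay for an error [j * B] that is linear in the offset [j]: below, [w] is the deficit
    [D], which is quadratic in [j]. *)
Lemma mul_bounds (j B w S : Z) : - S <= B <= S -> - w <= j <= w ->
  - (j * B) <= w * S.
Proof.
move=> hB hj.
have h1 : 0 <= (S - B) * (w + j) by apply: Z.mul_nonneg_nonneg; lia.
have h2 : 0 <= (S + B) * (w - j) by apply: Z.mul_nonneg_nonneg; lia.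
nia.
Qed.

(** With parts [k - j] and [k + j] the deficit is j^2, the cubic changes by j B with B = O(k^2), and
    |j| <= j^2 for integers. *)
Lemma cubic_even (k p r D : Z) : 2 <= k -> 0 <= p -> 0 <= r ->
  p + r = 2 * k -> D + p * r = k * k ->
  k * (k - 1) * (k - 2) <= r * (r - 1) * (p - 2) + 8 * D * (2 * k) ^ 2.
Proof.
move=> k2 p0 r0 pr Dpr; pose j := r - k.
have -> : D = j * j by rewrite /j; nia.
have [r_j p_j] : r = k + j /\ p = k - j by rewrite /j; lia.
move: j r_j p_j => j r_j p_j; subst r p.
set B := (2 * k - 1 + j) * (k - j - 2) - k * (k - 1).
have -> : (k + j) * (k + j - 1) * (k - j - 2) =
  k * (k - 1) * (k - 2) + j * B by rewrite /B; ring.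
suff : - (j * B) <= (j * j) * (8 * (2 * k) ^ 2) by lia.
by apply: mul_bounds; rewrite /B; nia.
Qed.

Lemma cubic_odd (k p r D : Z) : 4 <= k -> 0 <= p -> 0 <= r ->
  p + r = 2 * k + 1 -> D + p * r = k * (k + 1) ->
  k * (k - 1) * (k - 1) <= r * (r - 1) * (p - 2) + 8 * D * (2 * k + 1) ^ 2.
Proof.
move=> k2 p0 r0 pr Dpr; pose j := r - k.
have -> : D = j * j - j by rewrite /j; nia.
have [r_j p_j] : r = k + j /\ p = k + 1 - j by rewrite /j; lia.
move: j r_j p_j => j r_j p_j; subst r p.
(* For j = 1 the deficit j^2 - j is 0 and cannot absorb any error; there (k + 1) k (k - 2) is
   compared directly. For every other integer, |j| <= j^2 - j. *)
case: (Z.eq_dec j 1) => [->|j1]; first by nia.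
set B := (2 * k - 1 + j) * (k - 1 - j) - k * (k - 1).
have -> : (k + j) * (k + j - 1) * (k + 1 - j - 2) =
  k * (k - 1) * (k - 1) + j * B by rewrite /B; ring.
suff : - (j * B) <= (j * j - j) * (8 * (2 * k + 1) ^ 2) by lia.
by apply: mul_bounds; rewrite /B; nia.
Qed.

End Arith.

Lemma mul_le_div4 n p r : p + r = n -> p * r <= n ^ 2 %/ 4.
Proof.
by move=> <-; rewrite leq_divRL // mulnC (nat_AGM2 p r).1.
Qed.

(** In a complete bipartite graph with parts [p] and [r], an edge added inside the part of size [p]
    closes [r * (r - 1) * (p - 2)] paths of length 4. Imbalance lowers this below the target by
    O(n^2) per unit of deficit. *)
Lemma unbalanced_cubic n p r : p + r = n -> 10 <= p -> 10 <= r ->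
  n./2 * (n./2 - 1) * (uphalf n - 2) <=
    r * (r - 1) * (p - 2) + 8 * (n ^ 2 %/ 4 - p * r) * n ^ 2.
Proof.
move=> pr_n p10 r10; have prD := mul_le_div4 pr_n.
set D := _ - p * r; have {prD} : D + p * r = n ^ 2 %/ 4 by exact: subnK.
move: D => D; have [p2 p_p2] : exists p2, p = p2.+2 by exists (p - 2); lia.
have [r1 r_r1] : exists r1, r = r1.+1 by exists (r - 1); lia.
have [k [nk|nk]] : exists k, n = 2 * k.+2 \/ n = 2 * k.+2 + 1.
- by exists (n./2 - 2); lia.
- have -> : n ^ 2 %/ 4 = k.+2 ^ 2 by rewrite nk (expnMn 2 _ 2) mulKn.
  have -> : n./2 = k.+2 by lia.
  have -> : uphalf n = k.+2 by lia.
  move=> D_eq.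
  have := @cubic_even (Z.of_nat k.+2) (Z.of_nat p) (Z.of_nat r) (Z.of_nat D).
  do 5!move=> /(_ ltac:(lia)).
  by rewrite p_p2 r_r1 nk !subSS !subn0; lia.
have -> : n ^ 2 %/ 4 = k.+2 * k.+3.
  by rewrite nk; lia.
have -> : n./2 = k.+2 by lia.
have -> : uphalf n = k.+3 by lia.
move=> D_eq.
have := @cubic_odd (Z.of_nat k.+2) (Z.of_nat p) (Z.of_nat r) (Z.of_nat D).
do 5!move=> /(_ ltac:(lia)).
by rewrite p_p2 r_r1 nk !subSS !subn0; lia.
Qed.

(** If p < 2n/5, the difference d of the parts exceeds n/5, while d^2 = n^2 - 4pr <= 4D + 3 <=
    n^2/1000 + 3. *)
Lemma part_bound n p r D : p + r = n -> 1000 <= n ->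
  4000 * D <= n ^ 2 -> n ^ 2 %/ 4 <= p * r + D -> 2 * n <= 5 * p.
Proof.
move=> <- n1000 hD h; rewrite leqNgt; apply/negP => lt_p.
have [d r_d] : exists d, r = p + d by exists (r - p); lia.
have {}h : d ^ 2 <= 4 * D + 3.
    have sq : (p + r) ^ 2 = 4 * (p * r) + d ^ 2 by rewrite r_d -!mulnn; lia.
    by move: h; rewrite sq; lia.
have n5 : p + r <= 5 * d by lia.
have : (p + r) ^ 2 <= 25 * d ^ 2 by rewrite -(expnMn 5 d 2) leq_exp2r.
have : 1000 * 1000 <= (p + r) ^ 2 by apply: leq_mul.
lia.
Qed.

(** The product is at least 0.05 * 0.049 * 0.39 n^3 > 0.00095 n^3 and the missing pairs cost at most
    n^3/2000, which leaves more than n^3/3000. *)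
Lemma cubic_le_of_large_degrees n cx cy p M N : 1000 <= n -> n <= 20 * cx -> n <= 20 * cy ->
  2 * n <= 5 * p -> 4000 * M <= n ^ 2 ->
  cx * cy.-1 * (p - 2) <= N + 2 * (M * n) -> n ^ 3 <= 3000 * N.
Proof.
move=> n1000 hx hy hp hM h.
have hy' : 49 * n <= 1000 * cy.-1 by lia.
have hp' : 39 * n <= 100 * (p - 2) by lia.
have h1 : n * (49 * n) * (39 * n) <= 20 * cx * (1000 * cy.-1) * (100 * (p - 2)).
  by apply: leq_mul => //; exact: leq_mul.
have h2 : 4000 * M * n <= n ^ 2 * n by rewrite leq_mul2r hM orbT.
nia.
Qed.

(** Raising both degrees to [r] costs at most 2Mn in the product of degrees, so 2Mn^2 after the
    factor [p - 2]; the given error 2Mn is at most another 2Mn^2. *)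
Lemma cubic_le_of_few_missing n cx cy p r M N : p + r = n -> cx <= r ->
  r <= cx + M -> r <= cy + M ->
  cx * cy.-1 * (p - 2) <= N + 2 * (M * n) ->
  r * (r - 1) * (p - 2) <= N + 4 * M * n ^ 2.
Proof.
move=> pr cxr hx hy h.
have h1 : r * (r - 1) <= cx * cy.-1 + 2 * M * n.
  have : r * (r - 1) <= (cx + M) * (r - 1) by rewrite leq_mul2r hx orbT.
  have : cx * (r - 1) <= cx * (cy.-1 + M) by rewrite leq_mul2l; lia.
  have : cx * M <= n * M by rewrite leq_mul2r; lia.
  have : M * (r - 1) <= M * n by rewrite leq_mul2l; lia.
  by rewrite mulnDl mulnDr; lia.
have : r * (r - 1) * (p - 2) <= (cx * cy.-1 + 2 * M * n) * (p - 2).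
  by rewrite leq_mul2r h1 orbT.
have : 2 * M * n * (p - 2) <= 2 * M * n * n by rewrite leq_mul2l; lia.
have nn : n <= n * n by case: (n) => // k; rewrite leq_pmulr.
have : M * n <= M * (n * n) by rewrite leq_mul2l nn orbT.
nia.
Qed.

Lemma balanced_cubic n : 1000 <= n ->
  n ^ 3 <= 10 * (n./2 * (n./2 - 1) * (uphalf n - 2)) /\
  n./2 * (n./2 - 1) * (uphalf n - 2) <= n ^ 3.
Proof.
move=> n1000.
have h1 : 49 * n <= 100 * n./2 by lia.
have h2 : 49 * n <= 100 * (n./2 - 1) by lia.
have h3 : 49 * n <= 100 * (uphalf n - 2) by lia.
split; last first.
  by rewrite !expnS muln1 mulnA; apply: leq_mul; [apply: leq_mul|]; lia.
have : 49 * n * (49 * n) * (49 * n) <=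
    100 * n./2 * (100 * (n./2 - 1)) * (100 * (uphalf n - 2)).
  by apply: leq_mul => //; exact: leq_mul.
nia.
Qed.

(** * Few triangles and cuts with few inside edges *)

(** Cauchy-Schwarz, by summing 2ab <= a^2 + b^2 over all pairs of indices. *)
Lemma sqr_sum_le (I : finType) (F : I -> nat) :
  (\sum_i F i) ^ 2 <= #|I| * \sum_i F i ^ 2.
Proof.
rewrite -(leq_pmul2l (isT : 0 < 2)) -mulnn big_distrl /= big_distrr /=.
apply: (@leq_trans (\sum_i \sum_j (F i ^ 2 + F j ^ 2))).
  apply: leq_sum => i _; rewrite big_distrr /= big_distrr /=.
  by apply: leq_sum => j _; exact: nat_Cauchy.
rewrite (eq_bigr (fun i => #|I| * F i ^ 2 + \sum_j F j ^ 2)); last first.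
  by move=> i _; rewrite big_split /= sum_nat_const.
by rewrite big_split /= -big_distrr /= sum_nat_const mul2n -addnn.
Qed.

Section Triangles.

Variables (T : finType) (e : rel T).
Hypotheses (e_sym : symmetric e) (e_irr : irreflexive e).

Local Notation n := #|T|.

Definition deg x : nat := \sum_y e x y.

Definition codeg y z : nat := \sum_x e x y * e x z.

Definition triangle_homs : nat := \sum_y \sum_z e y z * codeg y z.

(** Ordered pairs are counted, so an uncut edge contributes 2; a maximum cut is a minimizer of
    [inside e]. *)
Definition inside (s : {set T}) : nat :=
  \sum_y \sum_z e y z * ((y \in s) == (z \in s)).

(** For each ordered edge yz let a, b be the indicators of xy, xz; then [a = b] + a + b = 1 +
    2ab. *)
Lemma inside_nbhd x :
  inside [set y | e x y] + 2 * \sum_y e x y * deg y =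
  \sum_y deg y + 2 * \sum_y \sum_z e y z * (e x y * e x z).
Proof.
have -> : 2 * \sum_y e x y * deg y =
    \sum_y \sum_z e y z * (e x y + e x z).
  rewrite [RHS](eq_bigr (fun y => \sum_z e y z * e x y + \sum_z e y z * e x z)).
    rewrite big_split /= [X in _ = _ + X]exchange_big /= mul2n -addnn.
    congr (_ + _); apply: eq_bigr => y _; rewrite /deg big_distrr /=;
      apply: eq_bigr => z _; rewrite mulnC //.
    by rewrite e_sym.
  by move=> y _; rewrite -big_split; apply: eq_bigr => z _; rewrite mulnDr.
rewrite /inside -big_split big_distrr -big_split; apply: eq_bigr => y _.
rewrite -big_split /= big_distrr -big_split /=; apply: eq_bigr => z _.
by rewrite !inE; case: (e y z); case: (e x y); case: (e x z).
Qed.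

(** Summing the identity over [x] leaves the triangle term once n E <= 2 \sum deg^2, where E is the
    degree sum; this follows from Cauchy-Schwarz and n^2 <= 2E. *)
Lemma sum_inside_nbhd : n ^ 2 <= 2 * \sum_y deg y ->
  \sum_x inside [set y | e x y] <= 2 * triangle_homs.
Proof.
set E := \sum_y deg y => dense.
have H : \sum_x inside [set y | e x y] + 2 * \sum_y deg y ^ 2 =
         n * E + 2 * triangle_homs.
  have -> : \sum_y deg y ^ 2 = \sum_x \sum_y e x y * deg y.
    rewrite exchange_big /=; apply: eq_bigr => y _.
    rewrite -big_distrl /= -mulnn; congr (_ * _).
    by apply: eq_bigr => z _; rewrite e_sym.
  have -> : triangle_homs =
      \sum_x \sum_y \sum_z e y z * (e x y * e x z).
    rewrite exchange_big /=; apply: eq_bigr => y _.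
    rewrite exchange_big /=; apply: eq_bigr => z _.
    by rewrite /codeg big_distrr.
  rewrite !(big_distrr 2) -big_split /= -sum_nat_const -big_split /=.
  by apply: eq_bigr => x _; exact: inside_nbhd.
have CS := sqr_sum_le deg; rewrite -/E in CS.
have : n * E <= 2 * \sum_y deg y ^ 2; last by move: H; lia.
case: (posnP n) => [->|n_gt0]; first by rewrite mul0n.
rewrite -(leq_pmul2l n_gt0); nia.
Qed.

Lemma near_bipartite : 0 < n -> n ^ 2 <= 2 * \sum_y deg y ->
  exists s, n * inside s <= 2 * triangle_homs.
Proof.
move=> n_gt0 /sum_inside_nbhd dense; case/card_gt0P: n_gt0 => x0 _.
case: (@arg_minnP _ x0 xpredT (fun x => inside [set y | e x y]) isT) => x _ xmin.
exists [set y | e x y]; apply: leq_trans dense.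
by rewrite -sum_nat_const; apply: leq_sum => y _; exact: xmin.
Qed.

(* Homomorphisms from K_{1,2,2}: hub p.2, opposite rim pairs p.1.1, p.1.2 and z, z'. *)
Definition wheel_homs : nat :=
  \sum_(p : T * T * T) \sum_z \sum_z'
    (e p.1.1 p.2 * e p.1.2 p.2 * (e p.2 z * e p.1.1 z * e p.1.2 z)
      * (e p.2 z' * e p.1.1 z' * e p.1.2 z')).

(** Cauchy-Schwarz over pairs (y, z) yields pairs of triangles on a common edge yz; regrouped by (x,
    x', y), a second Cauchy-Schwarz over triples doubles [z]. *)
Lemma triangle_wheel : triangle_homs ^ 4 <= n ^ 7 * wheel_homs.
Proof.
pose f (p : T * T * T) : nat :=
  e p.1.1 p.2 * e p.1.2 p.2 * \sum_z e p.2 z * e p.1.1 z * e p.1.2 z.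
have h1 : triangle_homs ^ 2 <= n ^ 2 * \sum_p f p.
  rewrite /triangle_homs pair_big /= -[n ^ 2]mulnn -card_prod.
  apply: leq_trans (sqr_sum_le _) _; rewrite leq_mul2l; apply/orP; right.
  rewrite -(pair_big xpredT xpredT (fun p y => f (p, y))) /=.
  rewrite -(pair_big xpredT xpredT (fun x x' => \sum_y f (x, x', y))) /=.
  rewrite -(pair_big xpredT xpredT (fun y z => (e y z * codeg y z) ^ 2)) /=.
  rewrite (eq_bigr (fun y => \sum_x \sum_x' f (x, x', y))); last first.
    move=> y _.
    rewrite (eq_bigr (fun z => \sum_x \sum_x' e x y * e x' y * (e y z * e x z * e x' z))).
      rewrite exchange_big /=; apply: eq_bigr => x _.
      rewrite exchange_big /=; apply: eq_bigr => x' _.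
      by rewrite /f /= big_distrr.
    move=> z _; rewrite expnMn -[codeg y z ^ 2]mulnn {1}/codeg big_distrl big_distrr /=.
    apply: eq_bigr => x _; rewrite /codeg !big_distrr /=; apply: eq_bigr => x' _.
    by case: (e y z); case: (e x y); case: (e x z); case: (e x' y); case: (e x' z).
  rewrite exchange_big /=; apply: leq_sum => x _.
  by rewrite exchange_big.
have h2 : (\sum_p f p) ^ 2 <= n ^ 3 * wheel_homs.
  have -> : n ^ 3 = #|{: T * T * T}| by rewrite !card_prod; lia.
  apply: leq_trans (sqr_sum_le _) _; rewrite leq_mul2l; apply/orP; right.
  apply: leq_sum => p _; rewrite /f expnMn -[(\sum_z _) ^ 2]mulnn big_distrl big_distrr /=.
  apply: leq_sum => z _; rewrite !big_distrr /=; apply: leq_sum => z' _.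
  by case: (e _ _); case: (e _ _); rewrite ?mul0n //= !mul1n.
have {}h1 : triangle_homs ^ 4 <= n ^ 4 * (\sum_p f p) ^ 2.
  by rewrite (expnM _ 2 2) (expnM _ 2 2) -expnMn leq_exp2r.
apply: leq_trans h1 _; rewrite (expnD n 4 3) -mulnA leq_mul2l h2.
by rewrite orbT.
Qed.

End Triangles.

(** * Copies of C5 and wheels *)

Lemma sum_bool_card (I : finType) (P : pred I) :
  \sum_i (P i : nat) = #|[set i | P i]|.
Proof.
rewrite -sum1_card [RHS]big_mkcond; apply: eq_bigr => i _.
by rewrite inE; case: (P i).
Qed.

Section Copies.

Variables (T : finType) (e : rel T).
Hypotheses (e_sym : symmetric e) (e_irr : irreflexive e).

Local Notation n := #|T|.

Definition C5_hom (f : {ffun 'I_5 -> T}) := [forall i, e (f i) (f (ordS i))].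

Definition C5_image (f : {ffun 'I_5 -> T}) : {set T} * {set {set T}} :=
  (f @: [set: 'I_5], [set f @: A | A : {set 'I_5} in edges C5]).

Lemma C5_image_copy (f : {ffun 'I_5 -> T}) : injectiveb f -> C5_hom f -> C5_image f \in C5_copies e.
Proof.
move=> f_inj /forallP f_hom; rewrite inE; apply/andP; split; last first.
  by apply/existsP; exists f; rewrite f_inj !eqxx.
apply/subsetP => _ /imsetP [_ /imsetP [[i j] /= ij ->] ->].
rewrite imsetU1 imset_set1; apply/imsetP; exists (f i, f j) => //.
rewrite inE in ij; rewrite inE /=.
by case/orP: ij => /eqP /= ->; rewrite // e_sym.
Qed.

(** All labellings of one copy map five indices into its five vertices. The crude factor 5^5 only
    enters the bound on triangles. *)
Lemma C5_homs_le : #|[set f : {ffun 'I_5 -> T} | injectiveb f && C5_hom f]| <=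
  5 ^ 5 * #|C5_copies e|.
Proof.
rewrite -sum1_card mulnC -sum_nat_const.
rewrite (partition_big C5_image (mem (C5_copies e))); last first.
  by move=> f; rewrite inE => /andP[]; exact: C5_image_copy.
apply: leq_sum => H _; rewrite sum1dep_card.
case: (set_0Vmem [set f | (f \in [set f : {ffun 'I_5 -> T} | injectiveb f && C5_hom f])
                          && (C5_image f == H)]) => [->|[g]].
  by rewrite cards0.
rewrite !inE => /andP[/andP[/injectiveP g_inj _] /eqP gH].
have cV : #|H.1| = 5 by rewrite -gH /= card_imset // cardsT card_ord.
rewrite -[X in X ^ _]cV -[X in _ ^ X](card_ord 5) -card_ffun_on.
apply/subset_leq_card/subsetP => f; rewrite !inE => /andP[_ /eqP <-].
by apply/ffun_onP => i; rewrite imset_f.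
Qed.

(** If x, x' differ and z, z' differ, then y x z x' z' is a five-cycle in the wheel. The degenerate
    cases [D1] (x = x') and [D2] (z = z') have four free vertices each. *)
Lemma wheel_homs_le : wheel_homs e <= 2 * n ^ 4 + 5 ^ 5 * #|C5_copies e|.
Proof.
pose W := [set t : T * T * T * T * T | let: (x, x', y, z, z') := t in
  [&& e x y, e x' y, e y z, e x z, e x' z, e y z', e x z' & e x' z']].
have -> : wheel_homs e = #|W|.
  rewrite -sum_bool_card /wheel_homs pair_big /= pair_big /=.
  apply: eq_bigr => -[[[[x x'] y] z] z'] _ /=.
  by case: (e x y); case: (e x' y); case: (e y z); case: (e x z); case: (e x' z);
    case: (e y z'); case: (e x z'); case: (e x' z').
pose D1 := [set (t.1.1.1, t.1.1.1, t.1.1.2, t.1.2, t.2) | t : T * T * T * T].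
pose D2 := [set (t.1.1.1, t.1.1.2, t.1.2, t.2, t.2) | t : T * T * T * T].
have card4 : #|{: T * T * T * T}| = n ^ 4 by rewrite !card_prod !expnS muln1 !mulnA.
have cD1 : #|D1| <= n ^ 4 by rewrite -card4; exact: leq_imset_card.
have cD2 : #|D2| <= n ^ 4 by rewrite -card4; exact: leq_imset_card.
suff h : #|W :\: (D1 :|: D2)| <= #|[set f : {ffun 'I_5 -> T} | injectiveb f && C5_hom f]|.
  have := C5_homs_le; have := (leq_card_setU D1 D2).1.
  have := cardsID (D1 :|: D2) W.
  have := subset_leq_card (subsetIr W (D1 :|: D2)); lia.
pose F (t : T * T * T * T * T) : {ffun 'I_5 -> T} := let: (x, x', y, z, z') := t in
  [ffun i => tnth [tuple y; x; z; x'; z'] i].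
have F_inj : injective F.
  move=> [[[[x x'] y] z] z'] [[[[u u'] v] w] w'] /ffunP eqF.
  have := eqF (inord 0); have := eqF (inord 1); have := eqF (inord 2).
  have := eqF (inord 3); have := eqF (inord 4).
  by rewrite !ffunE !(tnth_nth y) !inordK //= => -> -> -> -> ->.
rewrite -(card_imset _ F_inj); apply/subset_leq_card/subsetP => f.
case/imsetP => -[[[[x x'] y] z] z']; rewrite !inE negb_or.
case/andP => /andP[tD1 tD2] /and5P[exy ex'y eyz exz /and4P[ex'z eyz' exz' ex'z']] ->.
have nxx' : x != x'.
  apply: contraNneq tD1 => <-; apply/imsetP.
  by exists (x, y, z, z').
have nzz' : z != z'.
  apply: contraNneq tD2 => <-; apply/imsetP.
  by exists (x, x', y, z).
have e_neq u v : e u v -> u != v by apply: contraTneq => ->; rewrite e_irr.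
apply/andP; split.
  apply/injectiveP => i j; rewrite !ffunE !(tnth_nth y) => /eqP.
  rewrite nth_uniq //; first by move/eqP/val_inj.
  rewrite /= !inE !negb_or nxx' nzz' (eq_sym y x) (eq_sym y x') !e_neq //.
  by rewrite e_sym.
rewrite /C5_hom; apply/forallP => i; rewrite !ffunE !(tnth_nth y) /=.
by case: i => -[|[|[|[|[|i]]]]] //= _; rewrite // e_sym.
Qed.

End Copies.

(** * Inside edges, cross edges and missing pairs of a cut *)

Lemma sum_rel_card (T : finType) (r : rel T) :
  \sum_x \sum_y (r x y : nat) = #|[set p | r p.1 p.2]|.
Proof. by rewrite pair_big /= sum_bool_card. Qed.

(** [o] selects one orientation of each related pair, and swapping coordinates matches the selected
    pairs with the others. *)
Lemma card_sym_rel (T : finType) (r o : rel T) : symmetric r ->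
  (forall x y, r x y -> o y x = ~~ o x y) ->
  #|[set p | r p.1 p.2]| = 2 * #|[set p | r p.1 p.2 && o p.1 p.2]|.
Proof.
move=> r_sym r_o; rewrite -(cardsID [set p | o p.1 p.2]) mul2n -addnn.
have swapK : involutive (fun p : T * T => (p.2, p.1)) by case.
congr (_ + _); first by apply: eq_card => p; rewrite !inE.
rewrite -(card_imset _ (inv_inj swapK)); apply: eq_card => -[x y].
rewrite inE /=; apply/imsetP/idP => [[[u v]]|xy].
  by rewrite !inE /= => /andP[nuv uv] [-> ->]; rewrite r_sym uv (r_o _ _ uv).
exists (y, x) => //; case/andP: xy; rewrite !inE /= r_sym => xy oxy.
by rewrite xy -(r_o _ _ xy) oxy.
Qed.

Section Cuts.

Variables (T : finType) (e : rel T).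
Hypotheses (e_sym : symmetric e) (e_irr : irreflexive e).

Local Notation n := #|T|.
Local Notation before x y := (enum_rank x < enum_rank y).

Lemma before_total x y : e x y -> before y x = ~~ before x y.
Proof.
move=> exy; have : enum_rank x != enum_rank y.
  by apply: contraTneq exy => /enum_rank_inj ->; rewrite e_irr.
by rewrite -(inj_eq val_inj) /=; lia.
Qed.

Lemma card_edges : #|edges e| = #|[set p | e p.1 p.2 && before p.1 p.2]|.
Proof.
have := e_sym; rewrite -(@card_in_imset _ _ (fun p : T * T => [set p.1; p.2])).
  move=> _; apply: eq_card => A; apply/imsetP/imsetP => [[[x y]]|[[x y]]].
    rewrite inE /= => exy ->; case: (boolP (before x y)) => xy.
      by exists (x, y); rewrite // inE /= exy.
    exists (y, x); last by rewrite /= setUC.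
    by rewrite inE /= e_sym exy before_total.
  by rewrite inE => /andP[exy _] ->; exists (x, y); rewrite ?inE.
move=> [x y] [u v]; rewrite !inE /= => /andP[_ xy] /andP[_ uv] /setP eqA.
have := eqA x; have := eqA y; rewrite !inE !eqxx orbT /=.
move=> /esym/orP[] /eqP eq1 /esym/orP[] /eqP eq2; move: xy uv; rewrite eq1 eq2 //; lia.
Qed.

Lemma sum_deg : \sum_x deg e x = 2 * #|edges e|.
Proof.
rewrite card_edges sum_rel_card.
exact: (@card_sym_rel _ e (fun x y => before x y) e_sym before_total).
Qed.

Section Cut.

Variable s : {set T}.

Local Notation same x y := ((x \in s) == (y \in s)).

(** Each unordered pair is represented once: within a part it is oriented by the enumeration of [T],
    across the cut it starts in [s]. *)
Definition in_edges := [set p | [&& e p.1 p.2, same p.1 p.2 & before p.1 p.2]].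
Definition cross_edges := [set p | [&& e p.1 p.2, ~~ same p.1 p.2 & p.1 \in s]].
Definition missing := [set p | [&& ~~ e p.1 p.2, ~~ same p.1 p.2 & p.1 \in s]].

Definition in_deg x := #|[set y | e x y && same x y]|.
Definition cross_deg x := #|[set y | e x y && ~~ same x y]|.
Definition missing_deg x := #|[set y | ~~ e x y && ~~ same x y]|.
Definition own_side x := [set y | same x y].
Definition other_side x := [set y | ~~ same x y].

Lemma side_cards x : #|own_side x| + #|other_side x| = n /\
  #|own_side x| * #|other_side x| = #|s| * #|~: s|.
Proof.
have -> : other_side x = ~: own_side x by apply/setP => y; rewrite !inE.
split; first exact: cardsC.
case: (boolP (x \in s)) => xs.
  have -> : own_side x = s by apply/setP => y; rewrite !inE xs; case: (y \in s).
  by [].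
have -> : own_side x = ~: s.
  by apply/setP => y; rewrite !inE (negPf xs); case: (y \in s).
by rewrite setCK mulnC.
Qed.

Lemma inside_card : inside e s = 2 * #|in_edges|.
Proof.
rewrite /inside (eq_bigr (fun x => \sum_y ((e x y && same x y) : nat))); last first.
  by move=> x _; apply: eq_bigr => y _; case: (e x y); rewrite ?mul1n ?mul0n.
rewrite (sum_rel_card (fun x y => e x y && same x y)).
rewrite (@card_sym_rel _ (fun x y => e x y && same x y) (fun x y => before x y)).
- by congr (2 * _); apply: eq_card => p; rewrite !inE andbA.
- by move=> x y; rewrite e_sym eq_sym.
- by move=> x y /andP[/before_total].
Qed.

Lemma card_edges_cut : #|edges e| = #|in_edges| + #|cross_edges|.
Proof.
rewrite card_edges -(cardsID [set p | same p.1 p.2]); congr (_ + _).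
  by apply: eq_card => p; rewrite !inE -andbA [_ && before _ _]andbC.
have r_sym : symmetric (fun x y => e x y && ~~ same x y).
  by move=> x y; rewrite e_sym eq_sym.
apply/eqP; rewrite -(eqn_pmul2l (isT : 0 < 2)); apply/eqP.
have h1 := @card_sym_rel _ _ (fun x y => before x y) r_sym.
have h2 := @card_sym_rel _ _ (fun x y => x \in s) r_sym.
transitivity #|[set p | e p.1 p.2 && ~~ same p.1 p.2]|.
  rewrite h1; last by move=> x y /andP[/before_total].
  by congr (2 * _); apply: eq_card => p; rewrite !inE andbCA andbA.
rewrite h2; last by move=> x y /andP[_]; case: (x \in s); case: (y \in s).
by congr (2 * _); apply: eq_card => p; rewrite !inE andbA.
Qed.

Lemma cross_missing : #|cross_edges| + #|missing| = #|s| * #|~: s|.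
Proof.
rewrite -cardsX -(cardsID [set p | e p.1 p.2] (setX _ _)).
by congr (_ + _); apply: eq_card => -[x y]; rewrite !inE /=;
  case: (e x y); case: (x \in s); case: (y \in s).
Qed.

Lemma cross_missing_deg x : cross_deg x + missing_deg x = #|other_side x|.
Proof.
rewrite -(cardsID [set y | e x y] (other_side x)).
by congr (_ + _); apply: eq_card => y; rewrite !inE // andbC.
Qed.

Lemma sum_missing_deg : \sum_x missing_deg x = 2 * #|missing|.
Proof.
pose r x y := ~~ e x y && ~~ same x y.
rewrite (eq_bigr (fun x => \sum_y (r x y : nat))); last first.
  by move=> x _; rewrite sum_bool_card.
rewrite sum_rel_card (@card_sym_rel _ r (fun x y => x \in s)).
- by congr (2 * _); apply: eq_card => p; rewrite !inE andbA.
- by move=> x y; rewrite /r e_sym eq_sym.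
- by move=> x y /andP[_] /=; case: (x \in s); case: (y \in s).
Qed.

Lemma missing_deg_le x : missing_deg x <= #|missing|.
Proof.
rewrite /missing_deg; have inj1 : injective (fun y : T => (x, y)) by move=> y z [].
have inj2 : injective (fun y : T => (y, x)) by move=> y z [].
case: (boolP (x \in s)) => xs.
  rewrite -(card_imset _ inj1); apply/subset_leq_card/subsetP => p /imsetP [y].
  by rewrite !inE => /andP[h1 h2] -> /=; rewrite h1 xs h2.
rewrite -(card_imset _ inj2); apply/subset_leq_card/subsetP => p /imsetP [y].
rewrite !inE => /andP[h1 h2] -> /=; rewrite e_sym h1 (negPf xs).
by move: h2; case: (y \in s).
Qed.

(* The triple (u, a, v) encodes the path x u a v y. *)
Definition cross_paths x y := [set t : T * T * T |
  let: (u, a, v) := t in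
  [&& e x u, e u a, e a v, e v y, ~~ same x u, same x a, ~~ same x v &
      [&& u != v, x != a & a != y]]].

(** Take u and v among the cross neighbours of x and y, and a in their part. Such a triple fails
    only if u = v, which turns [cross_deg y] into its predecessor, or if ua or av is missing, at
    most [#|missing| * n] triples each. *)
Lemma cross_paths_lower x y : e x y -> same x y ->
  cross_deg x * (cross_deg y).-1 * (#|own_side x| - 2) <=
    #|cross_paths x y| + 2 * (#|missing| * n).
Proof.
move=> exy sxy; pose X := [set u | e x u && ~~ same x u].
pose Y := [set u | e y u && ~~ same y u]; pose P := own_side x :\ x :\ y.
have cP : #|P| = #|own_side x| - 2.
  have yx : y != x by apply: contraTneq exy => ->; rewrite e_irr.
  have := cardsD1 x (own_side x); have := cardsD1 y (own_side x :\ x).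
  by rewrite !inE eqxx sxy yx /= => -> ->; rewrite addnA addKn.
(* Failing triples: ua missing in [B1], av missing in [B2], u = v in [B3]. The test on [x] is there
   because members of [missing] start in [s]. *)
pose B1 := [set (if x \in s then (q.1.2, q.1.1, q.2) else (q.1.1, q.1.2, q.2))
  | q in setX missing [set: T]].
pose B2 := [set (if x \in s then (q.2, q.1.1, q.1.2) else (q.2, q.1.2, q.1.1))
  | q in setX missing [set: T]].
pose B3 := [set (q.1, q.2, q.1) | q in setX X P].
have cB1 : #|B1| <= #|missing| * n.
  by rewrite -cardsT -cardsX; exact: leq_imset_card.
have cB2 : #|B2| <= #|missing| * n.
  by rewrite -cardsT -cardsX; exact: leq_imset_card.
have cB3 : #|B3| <= #|X| * #|P| by rewrite -cardsX; exact: leq_imset_card.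
have sub : setX (setX X P) Y \subset cross_paths x y :|: B1 :|: B2 :|: B3.
  apply/subsetP => -[[u a] v]; rewrite !in_setX /= => /andP[/andP[uX aP] vY].
  rewrite !in_setU; case: (eqVneq u v) => [uv|nuv].
    apply/orP; right; apply/imsetP; exists (u, a); rewrite /= ?uv //.
    by rewrite in_setX -{1}uv uX.
  move: uX aP vY; rewrite !inE => /andP[exu sxu] /and3P[nay nax sxa] /andP[eyv syv].
  have sxv : ~~ same x v by rewrite (eqP sxy).
  case: (boolP (e u a)) => [eua|neua]; last first.
    do 2![apply/orP; left]; apply/orP; right; apply/imsetP.
    case: (boolP (x \in s)) => xs.
      exists (a, u, v) => //; rewrite !inE /= e_sym neua andbT -(eqP sxa) sxu xs //.
    exists (u, a, v) => //; rewrite !inE /= neua -(eqP sxa) eq_sym sxu.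
    by move: sxu; rewrite (negPf xs); case: (u \in s).
  case: (boolP (e a v)) => [eav|neav]; last first.
    apply/orP; left; apply/orP; right; apply/imsetP.
    case: (boolP (x \in s)) => xs.
      exists (a, v, u) => //; rewrite !inE /= neav andbT -(eqP sxa) sxv xs //.
    exists (v, a, u) => //; rewrite !inE /= e_sym neav -(eqP sxa) eq_sym sxv.
    by move: sxv; rewrite (negPf xs); case: (v \in s).
  do 3![apply/orP; left].
  by rewrite exu (e_sym v y) eyv sxu sxa sxv nuv (eq_sym x a) nax nay.
have := subset_leq_card sub; rewrite !cardsX cP.
have := (leq_card_setU (cross_paths x y :|: B1 :|: B2) B3).1.
have := (leq_card_setU (cross_paths x y :|: B1) B2).1.
have := (leq_card_setU (cross_paths x y) B1).1.
rewrite -/(cross_deg x) -/(cross_deg y) cP in cB3 *.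
have -> : cross_deg x * (cross_deg y).-1 * (#|own_side x| - 2) =
  cross_deg x * (#|own_side x| - 2) * cross_deg y - cross_deg x * (#|own_side x| - 2).
  by rewrite -subn1 mulnAC mulnBr muln1.
lia.
Qed.

End Cut.

(** Moving [x] across the cut swaps its two degrees and leaves all pairs avoiding [x] as they
    are. *)
Lemma minimal_cut_deg s x : (forall s', inside e s <= inside e s') ->
  in_deg s x <= cross_deg s x.
Proof.
move=> s_min.
pose s' := [set y | if y == x then x \notin s else y \in s].
have split t : inside e t = 2 * in_deg t x +
    \sum_(y | y != x) \sum_(z | z != x) e y z * ((y \in t) == (z \in t)).
  have in_degE : in_deg t x = \sum_y e x y * ((x \in t) == (y \in t)).
    rewrite /in_deg -sum_bool_card; apply: eq_bigr => y _.
    by case: (e x y); rewrite ?mul1n.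
  rewrite /inside (bigD1 x) //= -in_degE mul2n -addnn -addnA; congr (_ + _).
  rewrite [in_deg t x]in_degE [X in _ = X + _](bigD1 x) //= e_irr mul0n add0n -big_split /=.
  apply: eq_bigr => y _; rewrite (bigD1 x) //=; congr (_ + _).
  by rewrite e_sym eq_sym.
have := s_min s'; rewrite !split.
have -> : in_deg s' x = cross_deg s x.
  apply: eq_card => y; rewrite !inE eqxx; case: (eqVneq y x) => [->|_].
    by rewrite e_irr.
  by case: (x \in s); case: (y \in s).
set S1 := (X in _ <= _ + X -> _); set S2 := (X in _ + X <= _ -> _).
have -> : S1 = S2.
  apply: eq_bigr => y yx; apply: eq_bigr => z zx.
  by rewrite !inE (negPf yx) (negPf zx).
by lia.
Qed.

End Cuts.

(** * Cross paths closed by an inside edge *)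

Section CrossPaths.

Variables (T : finType) (e : rel T).
Hypotheses (e_sym : symmetric e) (e_irr : irreflexive e).
Variable s : {set T}.

Local Notation n := #|T|.
Local Notation same x y := ((x \in s) == (y \in s)).

Lemma C5_imageE (f : {ffun 'I_5 -> T}) A :
  reflect (exists i, A = [set f i; f (ordS i)]) (A \in (C5_image f).2).
Proof.
apply: (iffP imsetP) => [[_ /imsetP[[i j] /= ij ->] ->]|[i ->]].
  rewrite imsetU1 imset_set1; rewrite inE in ij.
  by case/orP: ij => /eqP /= ->; [exists i | exists j; rewrite setUC].
exists [set i; ordS i]; last by rewrite imsetU1 imset_set1.
by apply/imsetP; exists (i, ordS i); rewrite // inE /C5 /= eqxx.
Qed.

Definition path_cycle (w : (T * T) * (T * T * T)) : {ffun 'I_5 -> T} :=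
  let: ((x, y), (u, a, v)) := w in [ffun i => tnth [tuple x; u; a; v; y] i].

Lemma path_cycle_edge x y u a v A :
  A \in (C5_image (path_cycle ((x, y), (u, a, v)))).2 ->
  A = [set y; x] \/
  [\/ A = [set x; u], A = [set u; a], A = [set a; v] | A = [set v; y]].
Proof.
case/C5_imageE => i ->; rewrite !ffunE !(tnth_nth x).
case: i => -[|[|[|[|[|i]]]]] //= _; [right|right|right|right|left] => //.
- by constructor 1.
- by constructor 2.
- by constructor 3.
- by constructor 4.
Qed.

Lemma path_cycle_edges x y u a v :
  let E := (C5_image (path_cycle ((x, y), (u, a, v)))).2 in
  [/\ [set x; u] \in E, [set u; a] \in E, [set v; y] \in E & [set y; x] \in E].
Proof.
have h i := introT (C5_imageE (path_cycle ((x, y), (u, a, v))) _)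
  (ex_intro _ i erefl).
split; [have := h (inord 0)|have := h (inord 1)|have := h (inord 3)|have := h (inord 4)];
  by rewrite !ffunE !(tnth_nth x) /= !inordK.
Qed.

Lemma set2_eq (x y u v : T) : [set x; y] = [set u; v] ->
  (x = u \/ x = v) /\ (y = u \/ y = v).
Proof.
by move=> eqA; split; apply/set2P; rewrite -eqA !inE eqxx ?orbT.
Qed.

(** The inside edge and the path can be read off the cycle: xy is its only edge that does not cross
    the cut, the enumeration tells x from y, and then u, v and a follow in turn from their
    neighbours. *)
Lemma sum_cross_paths_le :
  \sum_(p in in_edges e s) #|cross_paths e s p.1 p.2| <= #|C5_copies e|.
Proof.
pose W := [set w : (T * T) * (T * T * T) |
  (w.1 \in in_edges e s) && (w.2 \in cross_paths e s w.1.1 w.1.2)].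
have -> : \sum_(p in in_edges e s) #|cross_paths e s p.1 p.2| = #|W|.
  rewrite -sum1dep_card -(pair_big_dep (fun p => p \in in_edges e s)
    (fun p t => t \in cross_paths e s p.1 p.2) (fun _ _ => 1)) /=.
  by apply: eq_bigr => p _; rewrite sum1_card.
rewrite -(@card_in_imset _ _ (fun w => C5_image (path_cycle w))).
  apply/subset_leq_card/subsetP => _ /imsetP[[[x y] [[u a] v]] wW ->].
  rewrite !inE /= in wW; case/andP: wW => /and3P[exy sxy _].
  case/and4P=> [exu eua eav /and5P[evy sxu sxa sxv /and3P[nuv nxa nay]]].
  have e_neq z t : e z t -> z != t by apply: contraTneq => ->; rewrite e_irr.
  have nxv : x != v by apply: contraNneq sxv => ->.
  have nuy : u != y by apply: contraNneq sxu => ->.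
  apply: C5_image_copy => //.
    apply/injectiveP => i j; rewrite !ffunE !(tnth_nth x) => /eqP.
    rewrite nth_uniq //; first by move/eqP/val_inj.
    rewrite /= !inE !negb_or nxa nuv nay nxv nuy !e_neq //.
  rewrite /C5_hom; apply/forallP => i; rewrite !ffunE !(tnth_nth x) /=.
  by case: i => -[|[|[|[|[|i]]]]] //= _; rewrite // e_sym.
move=> [[x y] [[u a] v]] [[x' y'] [[u' a'] v']]; rewrite !inE /=.
case/andP=> /and3P[_ /eqP sxy xy].
case/and4P=> [_ _ _ /and5P[_ sxu /eqP sxa sxv /and3P[/eqP nuv /eqP nxa /eqP nay]]].
case/andP=> /and3P[_ /eqP sxy' xy'].
case/and4P=> [_ _ _ /and5P[_ sxu' /eqP sxa' sxv' /and3P[/eqP nuv' /eqP nxa' /eqP nay']]].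
move: sxu sxv sxu' sxv' => /eqP sxu /eqP sxv /eqP sxu' /eqP sxv'.
move/(congr1 snd); have := path_cycle_edges x y u a v.
set E := (C5_image _).2 => -[xu ua vy yx] eqE.
rewrite /= -/E in eqE; move: xu ua vy yx; rewrite eqE.
move=> /path_cycle_edge xu /path_cycle_edge ua /path_cycle_edge vy /path_cycle_edge yx.
have nxy : x <> y by move=> xy0; rewrite xy0 ltnn in xy.
have [? ?] : x = x' /\ y = y'.
  case: yx => [|[]] /set2_eq [] [] eq1 [] eq2; try congruence; first by [].
  by move: xy xy'; rewrite eq1 eq2; lia.
subst x' y'.
have ? : u = u'.
  by case: xu => [|[]] /set2_eq [] [] eq1 [] eq2; congruence.
have ? : v = v'.
  by case: vy => [|[]] /set2_eq [] [] eq1 [] eq2; congruence.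
subst u' v'.
have ? : a = a'.
  by case: ua => [|[]] /set2_eq [] [] eq1 [] eq2; congruence.
by subst a'.
Qed.

End CrossPaths.

(** * Counting in a maximum cut *)

Section Counting.

Variables (T : finType) (e : rel T).
Hypotheses (e_sym : symmetric e) (e_irr : irreflexive e).

Variable n : nat.
Hypothesis card_T : #|T| = n.

Lemma few_triangles : 1000 ^ 5 <= n ->
  5 ^ 5 * #|C5_copies e| <= n ^ 4 -> 4000 * triangle_homs e <= n ^ 3.
Proof.
move=> n_large few; have := triangle_wheel e; have := wheel_homs_le e_sym e_irr.
rewrite card_T.
set t := triangle_homs e => wheel_le t_le.
have {}t_le : t ^ 4 <= n ^ 7 * (3 * n ^ 4).
  by apply: leq_trans t_le _; rewrite leq_mul2l; apply/orP; right; lia.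
rewrite -(leq_exp2r _ _ (isT : 0 < 4)) expnMn -expnM.
apply: (@leq_trans (4000 ^ 4 * (n ^ 7 * (3 * n ^ 4)))).
  by rewrite leq_mul2l t_le orbT.
(* The constant 4^4 * 3 = 768 is below 1000, so n >= 1000^5 supplies the twelfth power of n. *)
have -> : 4000 ^ 4 * (n ^ 7 * (3 * n ^ 4)) = 4 ^ 4 * 3 * 1000 ^ 4 * n ^ 11.
  by rewrite (expnD n 7 4); lia.
rewrite (expnSr n 11) mulnC leq_mul2l; apply/orP; right.
apply: leq_trans n_large; rewrite (expnSr 1000 4) mulnC leq_mul2l.
by apply/orP; right.
Qed.

Lemma max_cut : exists s, forall s', inside e s <= inside e s'.
Proof.
case: (@arg_minnP _ (set0 : {set T}) xpredT (inside e) isT) => s _ s_min.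
by exists s => s'; exact: s_min.
Qed.

Section Cut.

Variable s : {set T}.

Definition low := [set x | 20 * cross_deg e s x < n].
Lemma in_low x : (x \in low) = (20 * cross_deg e s x < n).
Proof. by rewrite inE. Qed.

Definition good_edges := [set p in in_edges e s | (p.1 \notin low) && (p.2 \notin low)].

(** An inside edge that is not good has a low endpoint; [Y] and its swap cover both possible
    orientations. *)
Lemma in_edges_good :
  #|in_edges e s| <= #|good_edges| + 2 * \sum_(x in low) in_deg e s x.
Proof.
pose Y := [set p : T * T | (p.1 \in low) &&
  (p.2 \in [set y | e p.1 y && ((p.1 \in s) == (y \in s))])].
have -> : \sum_(x in low) in_deg e s x = #|Y|.
  rewrite -sum1dep_card -(pair_big_dep (fun x => x \in low)
    (fun x y => y \in [set y | e x y && ((x \in s) == (y \in s))]) (fun _ _ => 1)) /=.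
  by apply: eq_bigr => x _; rewrite sum1_card.
have sub : in_edges e s \subset good_edges :|: Y :|: [set (p.2, p.1) | p in Y].
  apply/subsetP => -[x y] p_in; move: (p_in); rewrite [(x, y) \in in_edges e s]inE /=.
  case/and3P => exy sxy _; rewrite !in_setU.
  case: (boolP (x \in low)) => [xl|xl].
    by apply/orP; left; apply/orP; right; rewrite inE /= xl inE exy sxy.
  case: (boolP (y \in low)) => [yl|yl].
    apply/orP; right; apply/imsetP; exists (y, x) => //.
    by rewrite inE /= yl inE e_sym exy eq_sym.
  by do 2![apply/orP; left]; rewrite inE p_in /= xl yl.
have := subset_leq_card sub.
have := (leq_card_setU (good_edges :|: Y) [set (p.2, p.1) | p in Y]).1.
have := (leq_card_setU good_edges Y).1.
have : #|[set (p.2, p.1) | p in Y]| <= #|Y| by exact: leq_imset_card.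
lia.
Qed.

Lemma low_sum_in_deg : (forall s', inside e s <= inside e s') ->
  20 * \sum_(x in low) in_deg e s x <= #|low| * n.
Proof.
move=> s_min; rewrite -sum_nat_const big_distrr /=; apply: leq_sum => x.
rewrite in_low => /ltnW; apply: leq_trans.
by rewrite leq_mul2l; exact: minimal_cut_deg.
Qed.

(** A low vertex misses at least 2n/5 - n/20 = 7n/20 cross pairs, and missing degrees add up to
    twice the missing pairs. *)
Lemma low_missing : (forall x, 2 * n <= 5 * #|other_side s x|) ->
  7 * (#|low| * n) <= 40 * #|missing e s|.
Proof.
move=> big_side.
have -> : 40 * #|missing e s| = 20 * (2 * #|missing e s|) by rewrite mulnA.
rewrite -(sum_missing_deg e_sym) !big_distrr /=.
rewrite mulnC -mulnA -sum_nat_const.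
apply: (@leq_trans (\sum_(x in low) 20 * missing_deg e s x)).
  apply: leq_sum => x; rewrite in_low => x_low.
  by have := big_side x; have := cross_missing_deg e s x; lia.
by rewrite [X in _ <= X](bigID (mem low)) /= leq_addr.
Qed.

End Cut.

(** A maximum cut has no more inside edges than the neighbourhood cut found by averaging. *)
Lemma good_cut q : 1000 ^ 5 <= n -> 0 < q -> 5 ^ 5 * #|C5_copies e| <= n ^ 4 ->
  #|edges e| = n ^ 2 %/ 4 + q ->
  exists s, 4000 * #|in_edges e s| <= n ^ 2 /\
    forall s', inside e s <= inside e s'.
Proof.
move=> n_large q_gt0 few e_card.
have n_gt0 : 0 < n by apply: leq_trans n_large; rewrite expn_gt0.
have [||s0 s0_in] := @near_bipartite _ _ e_sym.
- by rewrite card_T; apply: leq_trans n_large; rewrite expn_gt0.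
- by rewrite card_T (sum_deg e_sym e_irr) e_card; lia.
rewrite card_T in s0_in; have [s s_min] := max_cut; exists s; split=> //.
have tri := few_triangles n_large few.
rewrite -(leq_pmul2l n_gt0) -expnS; apply: leq_trans tri.
have : n * inside e s <= n * inside e s0 by rewrite leq_mul2l s_min orbT.
by rewrite (inside_card e_sym e_irr); lia.
Qed.

Lemma many_copies q : 1000 ^ 5 <= n -> 0 < q -> 1000 * 1000 * q <= n ->
  #|edges e| = n ^ 2 %/ 4 + q ->
  q * (n./2 * (n./2 - 1) * (uphalf n - 2)) <= #|C5_copies e|.
Proof.
move=> n_large q_gt0 q_le e_card; rewrite leqNgt; apply/negP => few.
have n1000 : 1000 <= n.
  by apply: leq_trans n_large; rewrite -[X in X <= _]expn1 leq_exp2l.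
have [C0_lower C0_upper] := balanced_cubic n1000; move: few C0_lower C0_upper.
set C0 := _ * (uphalf n - 2); set C := #|C5_copies e| => few C0_lower C0_upper.
have C_lt : 1000 * 1000 * C < n ^ 4.
  have : q * C0 <= q * n ^ 3 by rewrite leq_mul2l C0_upper orbT.
  have : 1000 * 1000 * q * n ^ 3 <= n * n ^ 3 by rewrite leq_mul2r q_le orbT.
  by rewrite -expnS; lia.
have [|s [in_le s_min]] := @good_cut q n_large q_gt0 _ e_card; first by rewrite -/C; lia.
have sides x : #|own_side s x| + #|other_side s x| = n /\
    #|own_side s x| * #|other_side s x| = #|s| * #|~: s|.
  by rewrite -card_T; exact: side_cards.
have cut := card_edges_cut e_sym e_irr s; have cross := cross_missing e s.
move: in_le cut cross; rewrite e_card.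
set I := #|in_edges e s|; set M := #|missing e s|; set X := #|cross_edges e s|.
move=> in_le cut cross.
have XM x : X + M = #|own_side s x| * #|other_side s x|.
  by rewrite (sides x).2.
have XM_le : X + M <= n ^ 2 %/ 4.
  by rewrite cross; apply: mul_le_div4; rewrite -card_T; exact: cardsC.
(* Since X + I = floor(n^2/4) + q, the product of the parts is at least floor(n^2/4) - I, so [I] can
   serve as the deficit. *)
have side_large x : 2 * n <= 5 * #|own_side s x| /\ 2 * n <= 5 * #|other_side s x|.
  have [own_other _] := sides x; split.
    by apply: (part_bound own_other n1000 in_le); rewrite -XM; lia.
  apply: (@part_bound n _ #|own_side s x| I) => //; first by rewrite addnC.
  by rewrite mulnC -XM; lia.
have M_le : 4000 * M <= n ^ 2 by lia.
have path_lower p : p \in in_edges e s ->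
    cross_deg e s p.1 * (cross_deg e s p.2).-1 * (#|own_side s p.1| - 2) <=
    #|cross_paths e s p.1 p.2| + 2 * (M * n).
  by rewrite inE => /and3P[exy sxy _]; rewrite -card_T; exact: cross_paths_lower.
have copies := sum_cross_paths_le e_sym e_irr s.
have good_le : 1000 * #|good_edges s| <= 3 * n.
  have : #|good_edges s| * n ^ 3 <= 3000 * C.
    apply: (@leq_trans (3000 * \sum_(p in good_edges s) #|cross_paths e s p.1 p.2|)).
      rewrite -sum_nat_const big_distrr /=; apply: leq_sum => p.
      rewrite inE => /andP[p_in]; rewrite !in_low -!leqNgt => /andP[low1 low2].
      exact: (cubic_le_of_large_degrees n1000 low1 low2 (side_large _).1 M_le (path_lower _ p_in)).
    rewrite leq_mul2l; apply: leq_trans copies.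
    rewrite [X in _ <= X](bigID (mem (good_edges s))) /=.
    apply: leq_trans (leq_addr _ _); apply: eq_leq; apply: eq_bigl => p.
    rewrite -[LHS]andTb; case: (boolP (p \in good_edges s)); last by rewrite !andbF.
    by rewrite [p \in good_edges s]inE => /andP[-> _].
  have n3 : 0 < n ^ 3 by rewrite expn_gt0; lia.
  move=> good_C; rewrite -(leq_pmul2r n3); move: C_lt; rewrite expnS; lia.
(* With L low vertices, 7Ln/40 <= M <= I <= 3n/1000 + Ln/10, which forces L <= 1/25. *)
have low0 : \sum_(x in low s) in_deg e s x = 0.
  have := low_sum_in_deg s_min; have := low_missing (fun x => (side_large x).2).
  have := in_edges_good s; rewrite -/I -/M => h1 h2 h3.
  have : #|low s| * n < n by lia.
  rewrite -[X in _ < X]mul1n ltn_pmul2r; last by lia.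
  by rewrite ltnS leqn0 cards_eq0 => /eqP ->; rewrite big_set0.
have I_le : 1000 * I <= 3 * n.
  by have := in_edges_good s; rewrite low0 -/I; lia.
pose D := n ^ 2 %/ 4 - (X + M).
have I_eq : I = q + M + D by rewrite /D; lia.
(* Per inside edge, imbalance loses at most 8Dn^2 cycles and missing pairs at most 4Mn^2. *)
have count : I * C0 <= C + I * ((8 * D + 4 * M) * n ^ 2).
  apply: (@leq_trans (\sum_(p in in_edges e s)
      (#|cross_paths e s p.1 p.2| + (8 * D + 4 * M) * n ^ 2))).
    rewrite -sum_nat_const; apply: leq_sum => p p_in.
    have [own_other _] := sides p.1.
    have [own_large other_large] := side_large p.1.
    have same_other : #|other_side s p.2| = #|other_side s p.1|.
      move: p_in; rewrite inE => /and3P[_ /eqP same _].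
      by apply: eq_card => x; rewrite !inE same.
    have deg1 := cross_missing_deg e s p.1; have deg2 := cross_missing_deg e s p.2.
    have miss1 := missing_deg_le e_sym s p.1; have miss2 := missing_deg_le e_sym s p.2.
    have := cubic_le_of_few_missing own_other _ _ _ (path_lower p p_in).
    move=> /(_ ltac:(lia) ltac:(lia) ltac:(lia)).
    have := unbalanced_cubic own_other _ _.
    move=> /(_ ltac:(lia) ltac:(lia)); rewrite -(XM p.1) -/D -/C0; lia.
  by rewrite big_split /= sum_nat_const leq_add2r.
(* If M = D = 0, then I = q and [count] already contradicts [few]. *)
have [MD|MD] := posnP (M + D).
  have [M0 D0] : M = 0 /\ D = 0 by lia.
  by move: count; rewrite I_eq M0 D0 !(muln0, mul0n, addn0) leqNgt few.
(* The M + D surplus edges bring at least (M + D) n^3/10, while all losses total at most 24 (M + D)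
   n^3/1000. *)
have := leq_mul I_le (leqnn ((8 * D + 4 * M) * n ^ 2)).
have : (M + D) * n ^ 3 <= (M + D) * (10 * C0) by rewrite leq_mul2l C0_lower orbT.
have : 0 < (M + D) * n ^ 3 by rewrite muln_gt0 MD expn_gt0; lia.
move: few count; rewrite {1}I_eq (expnS n 2); lia.
Qed.

End Counting.

(** * The bound with a real constant *)

Import Order.TTheory GRing.Theory Num.Theory.

Theorem mainTheorem2 (R : realType) :
  exists c : R, (0 < c)%R /\
  exists n0 : nat, forall n q : nat,
    n0 <= n -> 1 <= q -> (q%:R < c * n%:R)%R ->
    forall (T : finType) (e : rel T),
      symmetric e -> irreflexive e ->
      #|T| = n -> #|edges e| = n ^ 2 %/ 4 + q ->
      q * n./2 * (n./2 - 1) * (uphalf n - 2) <= #|C5_copies e|.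
Proof.
(* With c = 10^-6 the hypothesis on q reads 10^6 q < n over the naturals. *)
exists ((1000 * 1000)%:R^-1)%R; split; first by rewrite invr_gt0 ltr0n.
exists (1000 ^ 5) => n q n_large q_gt0 q_lt T e e_sym e_irr cT e_card.
have := many_copies e_sym e_irr cT n_large q_gt0 _ e_card.
rewrite !mulnA; apply; move: q_lt.
by rewrite mulrC ltr_pdivlMr ?ltr0n // -natrM ltr_nat mulnC => /ltnW.
Qed.
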